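(* Let $\mathcal{A}$ be a finite alphabet and let $\mathcal{P}\subseteq\mathcal{A}^{\mathbb{N}}$ be a path set with a reachable presentation $(\mathcal{G},v)$ whose labeled graph $\mathcal{G}$ is right-resolving. Then $$H_p(\mathcal{P})=\log\lambda,$$ where $\lambda$ is the spectral radius of the adjacency matrix $A$ of the underlying directed graph $G$ of $\mathcal{G}$. If in addition $\mathcal{G}$ is irreducible, then so is $A$, and then $\lambda$ is the Perron eigenvalue of $A$.
   Context: $\mathcal{A}^{\mathbb{N}}$ is the set of one-sided infinite sequences $a_0a_1a_2\cdots$ with $a_i\in\mathcal{A}$. A labeled directed graph over $\mathcal{A}$ is a finite directed graph $\mathcal{G}$ whose edges carry labels from $\mathcal{A}$; loops and multiple edges are allowed, but the triples (initial vertex, terminal vertex, label) are required to be distinct. A pointed graph $(\mathcal{G},v)$ is such a graph with a distinguished vertex $v$. The path set $X_{\mathcal{G}}(v)$ is the set of all sequences of successive edge labels of one-sided infinite walks in $\mathcal{G}$ starting at $v$; $(\mathcal{G},v)$ is a presentation of $\mathcal{P}$ if $\mathcal{P}=X_{\mathcal{G}}(v)$, and $\mathcal P$ is a path set if it has a presentation. A presentation $(\mathcal{G},v)$ is reachable if each vertex of $\mathcal{G}$ can be reached from $v$ by a directed path (possibly of length $0$). $\mathcal{G}$ is right-resolving if at each vertex all exit edges have distinct labels. The underlying directed graph $G$ is $\mathcal{G}$ with labels forgotten, keeping multiple edges; its adjacency matrix $A$ has entry $A_{uw}$ equal to the number of edges from $u$ to $w$. $\mathcal{G}$ is irreducible if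 for every ordered pair of vertices $(u,w)$ there is a directed path of positive length from $u$ to $w$; correspondingly a nonnegative square matrix $A$ is irreducible if for all indices $(u,w)$ there is $k\ge 1$ with $(A^k)_{uw}>0$. The Perron eigenvalue of an irreducible nonnegative square matrix is its unique real eigenvalue $\lambda>0$ with $\lambda\ge|\mu|$ for every eigenvalue $\mu$. The path topological entropy is $H_p(\mathcal{P})=\limsup_{n\to\infty}\frac1n\log N^I_n(\mathcal{P})$, where $N^I_n(\mathcal{P})$ is the number of distinct initial blocks $a_0\cdots a_{n-1}$ of length $n$ of sequences in $\mathcal{P}$. In the degenerate case $\mathcal{P}=\emptyset$ use the convention $\log 0=-\infty$. *)

(* Defs.v *)
From HB Require Import structures.
From mathcomp Require Import all_boot all_order all_algebra.
From mathcomp Require Import all_classical all_reals all_analysis.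
From mathcomp Require Import complex.

Set Implicit Arguments.
Unset Strict Implicit.
Unset Printing Implicit Defensive.

Import Order.TTheory GRing.Theory Num.Theory.
Import ComplexField.Normc.

Local Open Scope classical_set_scope.
Local Open Scope ring_scope.
Local Open Scope complex_scope.

(* The edge from u to w labeled a is the triple (u, w, a): since edges form a
   set of triples, multiple edges are allowed only with distinct labels. *)
Definition lgraph (V A : finType) := {set V * V * A}.

Section LabeledGraphs.
Variables V A : finType.
Implicit Types (G : lgraph V A) (u v w : V) (P : set (nat -> A)).

Definition path_set_of G v : set (nat -> A) :=
  [set a | exists2 x : nat -> V, x 0%N = v
             & forall n, (x n, x n.+1, a n) \in G].

Definition is_presentation G v P := P = path_set_of G v.

Definition adjacent G : rel V := fun u w => [exists a, (u, w, a) \in G].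

Definition reachable G v := forall w, connect (adjacent G) v w.

Definition right_resolving G :=
  forall u w w' a, (u, w, a) \in G -> (u, w', a) \in G -> w = w'.

Definition irreducible_lgraph G :=
  forall u w, exists p : seq V,
    [/\ p != [::], path (adjacent G) u p & last u p = w].

(* Matrices are indexed by ordinals; vertices are numbered by [enum_val]. *)
Definition adjacency_mx (R : pzSemiRingType) G : 'M[R]_#|V| :=
  \matrix_(i, j) #|[pred a | (enum_val i, enum_val j, a) \in G]|%:R.

End LabeledGraphs.

Definition is_initial_block (A : finType) (P : set (nat -> A)) n
    (b : n.-tuple A) :=
  exists2 a, P a & b = [tuple a i | i < n].

Definition num_initial_blocks (A : finType) (P : set (nat -> A)) n : nat :=
  #|[pred b : n.-tuple A | `[< is_initial_block P b >]]|.

(* [lne] is the extended logarithm, with [lne 0 = -oo]; the junk value at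
   n = 0 does not affect the limsup. *)
Definition path_entropy (R : realType) (A : finType) (P : set (nat -> A)) :
    \bar R :=
  limn_esup (fun n =>
    (n%:R^-1)%:E * lne (num_initial_blocks P n)%:R%:E)%E.

Section Spectrum.
Variables (R : realType) (n : nat).
Implicit Types (M : 'M[R]_n) (l : R) (z : R[i]).

Definition complex_eigenvalue M z : bool :=
  eigenvalue (map_mx (real_complex R) M) z.

(* For n > 0 the set is finite and nonempty, so the sup is a maximum. *)
Definition spectral_radius M : R :=
  sup [set normc z | z in [set z | complex_eigenvalue M z]].

Definition irreducible_mx M :=
  forall i j, exists2 k, (0 < k)%N & 0 < (M ^+ k) i j.

Definition is_perron_eigenvalue M :=
  unique (fun l => [/\ 0 < l, complex_eigenvalue M l%:C
                     & forall z, complex_eigenvalue M z -> normc z <= l]).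

End Spectrum.

(* Main.v *)
(** Since the graph is right-resolving, a block is the label of at most one
    walk from a given vertex, so the vector of block counts satisfies
    [L_(n+1) = M L_n], i.e. [L_n = M^n L_0].

    Upper bound: factoring the characteristic polynomial over [R[i]],
    Cayley-Hamilton says that the sequence [M^n] is killed by a product of
    operators [shift - z] with [z] an eigenvalue, and each factor can be
    inverted without leaving the sequences that are [O(r^n)], for any
    [r > rho].

    Lower bound: let [M x = z x] with [|z| = rho > 0].  Every vertex in the
    support of [x] has a successor in the support, hence starts an infinite
    walk; so [|x| <= K L_0] and [rho^n |x| <= M^n |x| <= K L_n].
    Reachability transfers this bound to the base vertex.

    For irreducible [M], [|x|] turns out to be an eigenvector for [rho]. *)

From mathcomp Require Import all_boot all_order all_algebra.
From mathcomp Require Import all_classical all_reals all_analysis.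
From mathcomp Require Import complex lra.
Require Import Defs.

Set Implicit Arguments.
Unset Strict Implicit.
Unset Printing Implicit Defensive.

Import Order.TTheory GRing.Theory Num.Theory.
Import ComplexField.Normc.
Import numFieldNormedType.Exports.

Local Open Scope classical_set_scope.
Local Open Scope ring_scope.
Local Open Scope complex_scope.

(** * Geometric growth of powers of a complex matrix *)

Lemma near_geometric_lt (R : realType) (c r s : R) :
  0 <= r -> r < s -> \forall n \near \oo, c * r ^+ n < s ^+ n.
Proof.
move=> r0 rs; have s0 : 0 < s by exact: le_lt_trans rs.
have q1 : `|r / s| < 1.
  by rewrite ger0_norm ?divr_ge0 ?(ltW s0)// ltr_pdivrMr// mul1r.
have : c *: ((r / s) ^+ n) @[n --> \oo] --> c *: (0 : R).
  by apply: cvgZr; exact: cvg_expr.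
rewrite scaler0 => /cvgr_lt /(_ 1 ltr01); apply: filterS => n.
rewrite /GRing.scale/= expr_div_n mulrA ltr_pdivrMr ?mul1r//.
by rewrite exprn_gt0.
Qed.

Section ComplexGrowth.
Variable R : realType.
Implicit Types (z : R[i]) (c r : R).

Lemma normc_normE z : (normc z)%:C = `|z|.
Proof. by []. Qed.

Lemma normc_ge0 z : 0 <= normc z.
Proof. by rewrite -lecR normc_normE normr_ge0. Qed.

Lemma normc_gt0 z : (0 < normc z) = (z != 0).
Proof. by rewrite -ltcR normc_normE normr_gt0. Qed.

Lemma normc_sum_le (I : Type) (s : seq I) (F : I -> R[i]) :
  normc (\sum_(i <- s) F i) <= \sum_(i <- s) normc (F i).
Proof.
rewrite -lecR normc_normE (le_trans (ler_norm_sum _ _ _))//.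
by rewrite rmorph_sum.
Qed.

Lemma normcX z n : normc (z ^+ n) = normc z ^+ n.
Proof. by elim: n => [|n IH]; rewrite ?normc1 // !exprS normcM IH. Qed.

Lemma normc_real (x : R) : normc x%:C = `|x|.
Proof. by rewrite /normc/= expr0n/= addr0 sqrtr_sqr. Qed.

Lemma shift_growth z (s : nat -> R[i]) c r :
  normc z < r -> 0 <= c ->
  (forall n, normc (s n.+1 - z * s n) <= c * r ^+ n) ->
  exists2 c', 0 <= c' & forall n, normc (s n) <= c' * r ^+ n.
Proof.
move=> zr c0 st; have r0 : 0 < r by apply: le_lt_trans zr; exact: normc_ge0.
have d0 : 0 < r - normc z by rewrite subr_gt0.
(* The first term covers [n = 0]; the second makes [c + normc z * c' <= r * c'], which closes the
   induction. *)
exists (normc (s 0%N) + c / (r - normc z)).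
  by rewrite addr_ge0 ?normc_ge0// divr_ge0// ltW.
elim=> [|n IH]; first by rewrite expr0 mulr1 lerDl divr_ge0// ltW.
have -> : s n.+1 = (s n.+1 - z * s n) + z * s n by rewrite subrK.
apply: (@le_trans _ _ (c * r ^+ n + normc z * normc (s n))).
  by rewrite (le_trans (le_normcD _ _))// normcM lerD2r.
set c' := _ + _ in IH *.
have cc' : c + normc z * c' <= r * c'.
  rewrite -lerBrDr -mulrBl /c' mulrDr mulrCA divff ?gt_eqF// mulr1 lerDr.
  by rewrite mulr_ge0 ?normc_ge0// ltW.
apply: (@le_trans _ _ ((c + normc z * c') * r ^+ n)).
  by rewrite mulrDl lerD2l -mulrA ler_wpM2l// normc_ge0.
by rewrite exprS mulrCA mulrA ler_wpM2r// exprn_ge0// ltW.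
Qed.

Lemma mxpow_growth n (A : 'M[R[i]]_n.+1) r :
  (forall z, eigenvalue A z -> normc z < r) ->
  forall i j, exists2 c : R, 0 <= c &
    forall k, normc ((A ^+ k) i j) <= c * r ^+ k.
Proof.
move=> Ar.
have [zs zsE] := closed_field_poly_normal (char_poly A).
rewrite (monicP (char_poly_monic A)) scale1r in zsE.
have {}Ar z : z \in zs -> normc z < r.
  by move=> zzs; apply: Ar; rewrite eigenvalue_root_char zsE root_prod_XsubC.
have A0 : \prod_(z <- zs) (A - z%:M) = 0.
  rewrite -(Cayley_Hamilton A) zsE rmorph_prod/=; apply: eq_bigr => z _.
  by rewrite rmorphB/= horner_mx_X horner_mx_C.
(* Replacing [B] by [B * (A - z%:M)] applies [shift - z] to the entries of [B * A ^+ k]. So the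
   factors can be removed one at a time, from the full product, which is zero, down to [B = 1]. *)
pose good (B : 'M[R[i]]_n.+1) := forall i j, exists2 c : R, 0 <= c &
  forall k, normc ((B * A ^+ k) i j) <= c * r ^+ k.
suff step B : good (B * \prod_(z <- zs) (A - z%:M)) -> good B.
  have H : good (1 * \prod_(z <- zs) (A - z%:M)).
    by move=> i j; exists 0 => // k; rewrite A0 mulr0 mul0r mxE mul0r normc0.
  move=> i j; have [c c0 Ac] := step _ H i j.
  by exists c => // k; rewrite -[A ^+ k]mul1r.
elim: zs Ar {zsE A0} B => [_ B|z zs IH Ar B]; first by rewrite big_nil mulr1.
rewrite big_cons mulrA => /IH H i j.
have {}/H/(_ i j)[] : forall z, z \in zs -> normc z < r.
  by move=> y yzs; apply: Ar; rewrite inE yzs orbT.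
move=> c c0 Bc; apply: (@shift_growth z _ c) => //.
  exact: Ar (mem_head _ _).
move=> k; have := Bc k; congr (normc _ <= _).
rewrite mulrBr mulrBl -mulrA -exprS [B * _%:M]mul_mx_scalar.
have entryE (X Y : 'M[R[i]]_n.+1) : (Y - z *: X) i j = Y i j - z * X i j.
  by rewrite !mxE.
by rewrite -[_ *: B * _]scalemxAl entryE.
Qed.
End ComplexGrowth.

(** * The spectral radius and the growth of real matrix powers *)

Lemma seq_argmax d (R : orderType d) (T : eqType) (f : T -> R) (s : seq T) :
  s != [::] -> exists2 x, x \in s & forall y, y \in s -> (f y <= f x)%O.
Proof.
elim: s => // x [_ _|y s IH _].
  by exists x; rewrite ?mem_head// => y /[1!inE] /eqP ->.
have [//|z zs zmax] := IH; have [xz|/ltW zx] := leP (f x) (f z).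
  exists z; first by rewrite inE zs orbT.
  by move=> w /[1!inE] /predU1P[->//|]; exact: zmax.
exists x; first exact: mem_head.
by move=> w /[1!inE] /predU1P[->//|/zmax/le_trans]; apply.
Qed.

Section SpectralRadius.
Variable R : realType.
Local Notation rho := (@spectral_radius R _).

(** The complex eigenvalues are the roots of the characteristic polynomial. They form a finite list,
    nonempty because the degree is positive, so the supremum is a maximum. *)
Lemma spectral_radius_attained n (M : 'M[R]_n.+1) :
  exists z, [/\ complex_eigenvalue M z, normc z = rho M
    & forall z', complex_eigenvalue M z' -> normc z' <= rho M].
Proof.
set MC := map_mx (real_complex R) M.
have [zs zsE] := closed_field_poly_normal (char_poly MC).
rewrite (monicP (char_poly_monic MC)) scale1r in zsE.
have evE z : complex_eigenvalue M z = (z \in zs).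
  by rewrite /complex_eigenvalue eigenvalue_root_char zsE root_prod_XsubC.
have zs0 : zs != [::].
  apply/eqP => zs0; have := size_char_poly MC.
  by rewrite zsE zs0 big_nil size_poly1.
have [z zzs zmax] := seq_argmax (@normc R) zs0.
suff rhoE : rho M = normc z.
  by exists z; split => //; rewrite ?evE// rhoE => y; rewrite evE; exact: zmax.
apply/eqP; rewrite eq_le; apply/andP; split.
  apply: ge_sup; first by exists (normc z), z; rewrite //= evE.
  by move=> _ [y /= + <-]; rewrite evE; exact: zmax.
apply: ub_le_sup; last by exists z; rewrite //= evE.
by exists (normc z) => _ [y /= + <-]; rewrite evE; exact: zmax.
Qed.

(** [eigenvalue] speaks of row vectors; a matrix and its transpose have the same characteristic
    polynomial, so column vectors serve as well. *)
Lemma eigenvalue_col n (F : fieldType) (A : 'M[F]_n) a :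
  reflect (exists2 x : 'cV_n, A *m x = a *: x & x != 0) (eigenvalue A a).
Proof.
have -> : eigenvalue A a = eigenvalue A^T a.
  rewrite !eigenvalue_root_char; congr root.
  rewrite /char_poly -det_tr; congr (\det _).
  by rewrite /char_poly_mx raddfB/= tr_scalar_mx map_trmx.
apply: (iffP eigenvalueP) => -[x xE x0].
  exists x^T; last by rewrite -trmx0 (inj_eq trmx_inj).
  by rewrite -[A]trmxK -trmx_mul xE linearZ.
exists x^T; last by rewrite -trmx0 (inj_eq trmx_inj).
by rewrite -trmx_mul xE linearZ.
Qed.

Lemma spectral_radius_growth n (M : 'M[R]_n) r : rho M < r ->
  forall i j, exists2 c : R, 0 <= c & forall k, `|(M ^+ k) i j| <= c * r ^+ k.
Proof.
case: n M => [M _ []//|n M rhor i j].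
have [z [_ _ zmax]] := spectral_radius_attained M.
have Mr y : complex_eigenvalue M y -> normc y < r.
  by move=> /zmax /le_lt_trans; apply.
have [c c0 Mc] := mxpow_growth Mr i j.
exists c => // k; rewrite -normc_real; have := Mc k.
by rewrite -rmorphXn/= mxE.
Qed.

Lemma spectral_radius_growth_col n (M : 'M[R]_n) r (x : 'cV_n) : rho M < r ->
  forall i, exists2 c : R, 0 <= c &
    forall k, (M ^+ k *m x) i 0 <= c * r ^+ k.
Proof.
move=> rhor i; pose g j c := 0 <= c /\ forall k, `|(M ^+ k) i j| <= c * r ^+ k.
have [c cP] : {c & forall j, g j (c j)}.
  by apply: choice => j; have [c] := spectral_radius_growth rhor i j; exists c.
exists (\sum_j c j * `|x j 0|).
  by apply: sumr_ge0 => j _; rewrite mulr_ge0//; have [] := cP j.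
move=> k; rewrite mxE mulr_suml; apply: ler_sum => j _.
rewrite (le_trans (ler_norm _))// normrM mulrAC ler_wpM2r//.
by have [_] := cP j.
Qed.

Lemma spectral_radius_ge0 n (M : 'M[R]_n.+1) : 0 <= rho M.
Proof.
by have [z [_ <- _]] := spectral_radius_attained M; exact: normc_ge0.
Qed.

End SpectralRadius.

(** * Perron-Frobenius theory for nonnegative matrices *)

Section PerronFrobenius.
Variable R : realType.
Local Notation rho := (@spectral_radius R _).

Lemma mulmx_nonneg m n p (X : 'M[R]_(m, n)) (Y : 'M[R]_(n, p)) :
  (forall i j, 0 <= X i j) -> (forall i j, 0 <= Y i j) ->
  forall i j, 0 <= (X *m Y) i j.
Proof.
by move=> X0 Y0 i j; rewrite mxE sumr_ge0// => k _; rewrite mulr_ge0.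
Qed.

Lemma mxpow_nonneg n (M : 'M[R]_n) : (forall i j, 0 <= M i j) ->
  forall k i j, 0 <= (M ^+ k) i j.
Proof.
move=> M0; elim=> [|k IH] i j; first by rewrite expr0 mxE; case: eqP.
by rewrite exprS; exact: mulmx_nonneg.
Qed.

(** A nonnegative matrix preserves the entrywise order, so the inequality [s * y <= M *m y] can be
    iterated. *)
Lemma supereigen_pow n (M : 'M[R]_n) (y : 'cV_n) s :
  (forall i j, 0 <= M i j) -> 0 <= s ->
  (forall i, s * y i 0 <= (M *m y) i 0) ->
  forall k i, s ^+ k * y i 0 <= (M ^+ k *m y) i 0.
Proof.
move=> M0 s0 My; elim=> [|k IH] i; first by rewrite mul1r mul1mx.
have -> : M ^+ k.+1 *m y = M *m (M ^+ k *m y) by rewrite exprS mulmxA.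
rewrite exprSr -mulrA.
apply: (@le_trans _ _ (s ^+ k * (M *m y) i 0)).
  by rewrite ler_wpM2l// exprn_ge0.
rewrite [X in X <= _]mulrC !mxE mulr_suml; apply: ler_sum => j _.
by rewrite -mulrA [y _ _ * _]mulrC ler_wpM2l.
Qed.

(** A Collatz-Wielandt bound. If [s] exceeded the spectral radius, then for [r] strictly between
    them [s ^+ k * y i 0] would be at most [c * r ^+ k] for all [k], which fails for large [k]. *)
Lemma supereigen_le_spectral_radius n (M : 'M[R]_n) (y : 'cV_n) s i :
  (forall i j, 0 <= M i j) -> 0 <= s -> 0 < y i 0 ->
  (forall i, s * y i 0 <= (M *m y) i 0) -> s <= rho M.
Proof.
case: n M y i => [? ? []//|n] M y i M0 s0 yi0 My.
rewrite leNgt; apply/negP => rs.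
pose r := (rho M + s) / 2.
have rhor : rho M < r by rewrite /r; lra.
have r0 : 0 <= r by rewrite (le_trans _ (ltW rhor))// spectral_radius_ge0.
have [c c0 Mc] := spectral_radius_growth_col y rhor i.
have rs' : r < s by rewrite /r; lra.
have [k _ /(_ k (leqnn k))/=] := near_geometric_lt (c / y i 0) r0 rs'.
rewrite ltNge => /negP; apply.
rewrite mulrAC ler_pdivlMr// (le_trans _ (Mc k))//.
exact: supereigen_pow.
Qed.

Lemma small_multiple_le (I : finType) (w d : I -> R) :
  (forall i, 0 < d i) -> exists2 e, 0 < e & forall i, e * w i <= d i.
Proof.
(* The bound is asked of every smaller positive factor too, so that it survives taking the minimum
   over [i]. *)
move=> d0; pose g i e := 0 < e /\ forall e', 0 < e' <= e -> e' * w i <= d i.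
have [e eP] : {e & forall i, g i (e i)}.
  apply: choice => i; exists (d i / (1 + `|w i|)).
  have w1 : 0 < 1 + `|w i| by rewrite ltr_pwDl.
  split=> [|e' /andP[e'0]]; first by rewrite divr_gt0.
  rewrite ler_pdivlMr//; apply: le_trans; rewrite ler_wpM2l ?(ltW e'0)//.
  by rewrite (le_trans (ler_norm _))// lerDr.
(* Starting the minimum at 1 keeps it positive even when [I] is empty. *)
have min_gt0 : 0 < \big[Num.min/1]_i e i.
  by apply/bigmin_gtP; split=> // i _; have [] := eP i.
exists (\big[Num.min/1]_i e i) => // i.
by have [_] := eP i; apply; rewrite min_gt0 bigmin_le.
Qed.

(** Only finitely many pairs [(i, j)] occur, so one [K] exceeds all their exponents; the remaining
    summands are nonnegative. *)
Lemma irreducible_sum_pow_gt0 n (M : 'M[R]_n) :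
  (forall i j, 0 <= M i j) -> irreducible_mx M ->
  exists K, forall i j, 0 < (\sum_(k < K) M ^+ k) i j.
Proof.
move=> M0 irrM.
have [k kP] : {k : 'I_n * 'I_n -> nat & forall p, 0 < (M ^+ k p) p.1 p.2}.
  apply: (@choice _ _ (fun p k => 0 < (M ^+ k) p.1 p.2)) => -[i j].
  by have [k _ Mk] := irrM i j; exists k.
pose K := \max_(p : 'I_n * 'I_n) k p; exists K.+1 => i j; rewrite summxE.
have kK : (k (i, j) < K.+1)%N by rewrite ltnS leq_bigmax.
rewrite (bigD1 (Ordinal kK))//=; apply: ltr_pwDl; first exact: (kP (i, j)).
by apply: sumr_ge0 => l _; exact: mxpow_nonneg.
Qed.

(* If equality failed, multiplying by a positive sum of powers of [M] would
   make the inequality strict in every coordinate, hence valid with a larger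
   factor than [rho M]. *)
Lemma irreducible_supereigen n (M : 'M[R]_n) (y : 'cV_n) :
  (forall i j, 0 <= M i j) -> irreducible_mx M ->
  (forall i, 0 <= y i 0) -> y != 0 ->
  0 <= rho M -> (forall i, rho M * y i 0 <= (M *m y) i 0) ->
  M *m y = rho M *: y.
Proof.
move=> M0 irrM y0 yN0 rho0 My.
have [i0 yi0] : exists i, 0 < y i 0.
  apply: contrapT => /forallNP yle; case/eqP: yN0; apply/colP => i.
  rewrite mxE; apply/eqP; rewrite eq_le y0 leNgt andbT.
  by apply/negP.
have [K] := irreducible_sum_pow_gt0 M0 irrM; set B := \sum_(k < K) _ => B0.
have B_gt0 (x : 'cV_n) i : (forall j, 0 <= x j 0) -> 0 < x i 0 ->
    forall j, 0 < (B *m x) j 0.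
  move=> x0 xi j; rewrite mxE (bigD1 i)//= ltr_pwDl ?mulr_gt0//.
  by apply: sumr_ge0 => l _; rewrite mulr_ge0// ltW.
pose d := M *m y - rho M *: y.
have d0 i : 0 <= d i 0 by have := My i; rewrite /d !mxE subr_ge0.
apply/eqP; rewrite -subr_eq0 -/d; apply/eqP/colP => j; rewrite [RHS]mxE.
apply/eqP; rewrite eq_le d0 andbT leNgt; apply/negP => dj.
have [e e0 ew] := small_multiple_le (fun i => (B *m y) i 0) (B_gt0 d j d0 dj).
suff : rho M + e <= rho M by rewrite gerDl leNgt e0.
apply: (@supereigen_le_spectral_radius _ M (B *m y) _ i0) => //.
- by rewrite addr_ge0// ltW.
- exact: B_gt0 yi0 _.
move=> i; rewrite mulrDl.
have -> : M *m (B *m y) = rho M *: (B *m y) + B *m d.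
  have MB : M *m B = B *m M by apply: commr_sum => k _; exact: commrX.
  by rewrite /d mulmxBr -scalemxAr addrC subrK !mulmxA MB.
rewrite [X in _ <= X]mxE [X in _ <= X + _]mxE lerD2l; exact: ew.
Qed.

Lemma perron_frobenius n (M : 'M[R]_n.+1) :
  (forall i j, 0 <= M i j) -> irreducible_mx M ->
  is_perron_eigenvalue M (rho M).
Proof.
move=> M0 irrM; have [z [zM zrho zmax]] := spectral_radius_attained M.
have rho0 := spectral_radius_ge0 M.
have [x Mx x0] := eigenvalue_col _ _ zM.
pose y : 'cV[R]_n.+1 := \col_i normc (x i 0).
have y0 i : 0 <= y i 0 by rewrite mxE normc_ge0.
have [j xj] : exists j, x j 0 != 0.
  apply: contrapT => /forallNP xE; case/eqP: x0; apply/colP => i.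
  by rewrite [RHS]mxE; apply/eqP/negPn/negP; exact: xE.
have yj : 0 < y j 0 by rewrite mxE normc_gt0.
have My : M *m y = rho M *: y.
  apply: irreducible_supereigen => //.
    by apply: contraTneq yj => ->; rewrite mxE ltxx.
  (* Triangle inequality in row [i] of [M x = z x]. *)
  move=> i; rewrite mxE -zrho -normcM.
  have -> : z * x i 0 = (z *: x) i 0 by rewrite mxE.
  rewrite -Mx !mxE (le_trans (normc_sum_le _ _))//.
  apply: ler_sum => k _; rewrite !mxE normcM normc_real.
  by rewrite ger0_norm.
split=> [|l [_ lM lmax]].
  split; last exact: zmax; last first.
    apply/eigenvalue_col; exists (map_mx (real_complex R) y).
      by rewrite -map_mxM My map_mxZ.
    apply: contraTneq yj => /matrixP/(_ j 0); rewrite !mxE => /complexI ->.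
    by rewrite ltxx.
  (* If the spectral radius were 0, every positive power of [M] would kill [y]; but some such power
     has a positive entry at [(j, j)], and [y j 0 > 0]. *)
  rewrite lt_def rho0 andbT; apply/eqP => rhoM0.
  have [[//|k] _] := irrM j j; apply/negP; rewrite -leNgt.
  have : (M ^+ k.+1 *m y) j 0 <= 0.
    by rewrite exprSr -mulmxE -mulmxA My rhoM0 scale0r mulmx0 mxE.
  apply: contraTT; rewrite -!ltNge => Mjj.
  rewrite mxE (bigD1 j)//= ltr_pwDl ?mulr_gt0//.
  by apply: sumr_ge0 => l _; rewrite mulr_ge0// mxpow_nonneg.
(* Uniqueness: [l] dominates the modulus of [z], which is the spectral radius, and is itself an
   eigenvalue. *)
apply/eqP; rewrite eq_le -{1}zrho lmax//=.
by have := zmax _ lM; rewrite normc_real; apply: le_trans; exact: ler_norm.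
Qed.
End PerronFrobenius.

(** * Recursion for the number of initial blocks *)

Section PathSetBlocks.
Variables V A : finType.
Implicit Types (G : lgraph V A) (u v w : V) (P : set (nat -> A)).

Lemma is_initial_blockE P n (b : n.-tuple A) :
  is_initial_block P b <-> exists2 a, P a & b = mkseq a n :> seq A.
Proof.
have tupleE (a : nat -> A) : [tuple a i | i < n] = mkseq a n :> seq A.
  by rewrite /= /mkseq -val_enum_ord -map_comp.
split=> -[a Pa ba]; exists a => //; first by rewrite -tupleE ba.
by apply: val_inj; rewrite /= ba -tupleE.
Qed.

(** Dropping the first edge of a walk leaves a walk from its second vertex; conversely an edge can
    be put in front of a walk. *)
Lemma initial_block_cons G u a n (b : n.-tuple A) :
  is_initial_block (path_set_of G u) (cons_tuple a b) <->
  exists2 w, (u, w, a) \in G & is_initial_block (path_set_of G w) b.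
Proof.
have mkseqSl (f : nat -> A) : mkseq f n.+1 = f 0%N :: mkseq (f \o succn) n.
  by rewrite /mkseq/= (iotaDl 1 0) -map_comp.
split.
  move=> /is_initial_blockE[f [x x0 xG]] /=; rewrite mkseqSl => -[-> bE].
  exists (x 1%N); first by rewrite -x0.
  apply/is_initial_blockE; exists (f \o succn) => //.
  by exists (x \o succn) => // k; exact: xG.
move=> [w uw /is_initial_blockE[f [x x0 xG] bE]]; apply/is_initial_blockE.
exists (fun k => if k is k'.+1 then f k' else a).
  exists (fun k => if k is k'.+1 then x k' else u) => // -[|k]; last exact: xG.
  by rewrite x0.
by rewrite mkseqSl /= bE.
Qed.

Lemma card_tupleS n (p : pred (n.+1.-tuple A)) :
  #|p| = (\sum_(a : A) \sum_(b : n.-tuple A) p (cons_tuple a b))%N.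
Proof.
rewrite -sum1_card big_mkcond/= pair_big/=.
rewrite (reindex (fun ab : A * n.-tuple A => cons_tuple ab.1 ab.2))/=.
  by apply: eq_bigr => ab _; case: ifP; rewrite -topredE/= => ->.
exists (fun t => (thead t, [tuple of behead t])) => [[a b] _|t _] /=.
  by congr pair; apply: val_inj.
by rewrite [RHS]tuple_eta; apply: val_inj.
Qed.

(** Blocks are sorted by their first label [a]. Right-resolving leaves at most one [w] reached from
    [u] by [a], so no block is counted twice in the sum over [w]. *)
Lemma num_initial_blocksS G u n : right_resolving G ->
  num_initial_blocks (path_set_of G u) n.+1 =
  (\sum_w #|[pred a | (u, w, a) \in G]| *
     num_initial_blocks (path_set_of G w) n)%N.
Proof.
move=> rrG; rewrite /num_initial_blocks card_tupleS.
pose blk w (b : n.-tuple A) := `[< is_initial_block (path_set_of G w) b >].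
(* The indicator of the block [a b] is a sum over [w] with at most one nonzero term. *)
transitivity
    (\sum_a \sum_(b : n.-tuple A) \sum_w ((u, w, a) \in G) * blk w b)%N.
  apply: eq_bigr => a _; apply: eq_bigr => b _; rewrite inE.
  have [[w uw wb]|ub] := pselect (exists2 w, (u, w, a) \in G &
      is_initial_block (path_set_of G w) b).
    rewrite (bigD1 w)//= uw /blk; have /asboolP -> := wb.
    rewrite big1 ?addn0/= => [|w' w'w].
      by rewrite asboolT//; apply/initial_block_cons; exists w.
    case: (boolP (_ \in G)) => // uw'; case/eqP: w'w; exact: rrG uw' uw.
  rewrite asboolF ?big1// => [w _|/initial_block_cons//].
  case: (boolP (_ \in G)) => //= uw; rewrite mul1n; apply/eqP; rewrite eqb0.
  by apply/asboolP => wb; apply: ub; exists w.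
have cardE (T : finType) (p : pred T) : #|p| = (\sum_t p t)%N.
  rewrite -sum1_card big_mkcond; apply: eq_bigr => t _.
  by rewrite -topredE/=; case: (p t).
under [RHS]eq_bigr do rewrite !cardE big_distrlr/=.
rewrite [RHS]exchange_big/=; apply: eq_bigr => a _.
by rewrite exchange_big.
Qed.
End PathSetBlocks.

(** * Block counts compared with powers of the adjacency matrix *)

Section PathSetGrowth.
Variables (R : realType) (V A : finType) (G : lgraph V A).
Implicit Types (u v w : V).
Local Notation M := (adjacency_mx R G).
Local Notation N u := (num_initial_blocks (path_set_of G u)).

Lemma adjacency_mx_ge0 i j : 0 <= M i j.
Proof. by rewrite mxE ler0n. Qed.

Lemma adjacency_mx_gt0 i j : (0 < M i j) = adjacent G (enum_val i) (enum_val j).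
Proof.
rewrite mxE ltr0n; apply/card_gt0P/existsP => -[a aG]; exists a.
  by rewrite inE in aG.
by rewrite inE.
Qed.

(** The exponent is the length of a path from [i] to [j]: the entries of [M] along it multiply to a
    positive term of the power's entry. *)
Lemma irreducible_adjacency_mx : irreducible_lgraph G -> irreducible_mx M.
Proof.
move=> irrG i j; have [p [p0 pG pj]] := irrG (enum_val i) (enum_val j).
exists (size p); first by rewrite lt0n size_eq0.
elim: p i pj pG {p0} => [|w p IH] i /=.
  by move=> /enum_val_inj -> _; rewrite expr0 mxE eqxx ltr01.
move=> pj /andP[iw wp]; rewrite -(enum_rankK w) in iw pj wp.
rewrite exprS -mulmxE mxE (bigD1 (enum_rank w))//= ltr_pwDl//.
  by rewrite mulr_gt0 ?adjacency_mx_gt0// IH.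
apply: sumr_ge0 => k _; rewrite mulr_ge0 ?adjacency_mx_ge0//.
by apply: mxpow_nonneg; exact: adjacency_mx_ge0.
Qed.

(** A successor function on [S] is chosen once and iterated from [u]. *)
Lemma path_set_nonempty (S : pred V) :
  (forall u, S u -> exists2 w, S w & adjacent G u w) ->
  forall u, S u -> path_set_of G u !=set0.
Proof.
move=> Snext u Su.
have [f fP] : {f : V -> V * A &
    forall u, S u -> S (f u).1 /\ (u, (f u).1, (f u).2) \in G}.
  apply: (@choice _ _
    (fun u wa => S u -> S wa.1 /\ (u, wa.1, wa.2) \in G)) => w.
  (* Outside [S] nothing is required, but [choice] needs some value; an edge at [u] supplies one. *)
  have [Sw|nSw] := boolP (S w); last first.
    have [t _ /existsP[a _]] := Snext u Su; by exists (t, a).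
  by have [t St /existsP[a wG]] := Snext w Sw; exists (t, a).
pose x n := iter n (fun w => (f w).1) u.
have Sx n : S (x n) by elim: n => //= n Sn; have [] := fP _ Sn.
by exists (fun n => (f (x n)).2); exists x => // n; have [] := fP _ (Sx n).
Qed.

Lemma num_initial_blocks_gt0 (P : set (nat -> A)) n :
  P !=set0 -> (0 < num_initial_blocks P n)%N.
Proof.
move=> [a Pa]; apply/card_gt0P; exists (mktuple (fun i : 'I_n => a i)).
by apply/asboolT; exists a.
Qed.

(** For [n = 0] the entry is 1 or 0 according to whether an infinite walk starts at the vertex, the
    only candidate block being the empty one. *)
Definition block_counts n : 'cV[R]_#|V| := \col_i (N (enum_val i) n)%:R.

Hypothesis rrG : right_resolving G.

Lemma block_countsE n : block_counts n = M ^+ n *m block_counts 0.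
Proof.
elim: n => [|n IH]; first by rewrite expr0 mul1mx.
rewrite exprS -mulmxE -mulmxA -IH; apply/colP => i.
rewrite !mxE num_initial_blocksS// natr_sum.
rewrite (reindex _ (onW_bij _ (enum_val_bij V)))/=.
by apply: eq_bigr => j _; rewrite !mxE natrM.
Qed.

Lemma num_initial_blocks_adjacent u w n :
  adjacent G u w -> (N w n <= N u n.+1)%N.
Proof.
move=> /existsP[a aG]; rewrite num_initial_blocksS// (bigD1 w)//=.
apply: leq_trans (leq_addr _ _); apply: leq_pmull.
by apply/card_gt0P; exists a.
Qed.

Lemma num_initial_blocks_connect u w : connect (adjacent G) u w ->
  exists k, forall n, (N w n <= N u (k + n))%N.
Proof.
move=> /connectP[p pG ->]; exists (size p) => n.
elim: p u pG => //= t p IH u /andP[ut tp].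
exact: leq_trans (IH _ tp) (num_initial_blocks_adjacent _ ut).
Qed.

Lemma num_initial_blocks_le u r : spectral_radius M < r ->
  exists c, forall n, (N u n)%:R <= c * r ^+ n.
Proof.
move=> rhor; have [c _ Mc] :=
  spectral_radius_growth_col (block_counts 0) rhor (enum_rank u).
by exists c => n; have := Mc n; rewrite -block_countsE mxE enum_rankK.
Qed.

Lemma eigenvalue_num_initial_blocks z : complex_eigenvalue M z -> z != 0 ->
  exists u, exists2 c, 0 < c & forall n, normc z ^+ n <= c * (N u n)%:R.
Proof.
move=> /eigenvalue_col[x Mx x0] z0.
have [i xi] : exists i, x i 0 != 0.
  apply: contrapT => /forallNP xE; case/eqP: x0; apply/colP => i.
  by rewrite [RHS]mxE; apply/eqP/negPn/negP; exact: xE.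
pose S u := x (enum_rank u) 0 != 0.
have Snext u : S u -> exists2 w, S w & adjacent G u w.
  move=> Su; apply: contrapT => noext.
  (* As [(M x) u = z * x u] is nonzero, some term [M u j * x j] is nonzero; that [j] is the
     successor. *)
  have : (z *: x) (enum_rank u) 0 != 0 by rewrite mxE mulf_neq0.
  rewrite -Mx mxE big1 ?eqxx// => j _; apply/eqP; rewrite mulf_eq0 -implyNb.
  apply/implyP => Muj; apply/negPn/negP => xj; apply: noext.
  exists (enum_val j); first by rewrite /S enum_valK.
  rewrite -[u]enum_rankK -adjacency_mx_gt0 lt_def adjacency_mx_ge0 andbT.
  by apply: contraNneq Muj => Muj; rewrite mxE Muj.
(* [K] bounds every [normc (x j 0)]; on the support [block_counts 0] is at least 1, and off it the
   left side vanishes. *)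
pose K := \sum_j normc (x j 0).
have xK j : normc (x j 0) <= K * block_counts 0 j 0.
  have [->|xj] := eqVneq (x j 0) 0.
    rewrite normc0 mulr_ge0 ?mxE ?ler0n// sumr_ge0// => k _.
    exact: normc_ge0.
  have N1 : 1 <= block_counts 0 j 0.
    rewrite mxE ler1n; apply: num_initial_blocks_gt0.
    by apply: (path_set_nonempty Snext); rewrite /S enum_valK.
  apply: (@le_trans _ _ K); last first.
    by rewrite ler_peMr// sumr_ge0// => k _; exact: normc_ge0.
  by rewrite /K (bigD1 j)//= lerDl sumr_ge0// => k _; exact: normc_ge0.
have xi0 : 0 < normc (x i 0) by rewrite normc_gt0.
have K0 : 0 < K.
  rewrite /K (bigD1 i)//= ltr_pwDl// sumr_ge0// => k _; exact: normc_ge0.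
exists (enum_val i), (K / normc (x i 0)); first by rewrite divr_gt0.
move=> n; rewrite mulrAC ler_pdivlMr// -normcX -normcM.
have -> : z ^+ n * x i 0 = (map_mx (real_complex R) (M ^+ n) *m x) i 0.
  suff -> : map_mx (real_complex R) (M ^+ n) *m x = z ^+ n *: x.
    by rewrite mxE.
  elim: n => [|n IH]; first by rewrite !expr0 map_mx1 mul1mx scale1r.
  by rewrite exprSr -mulmxE map_mxM -mulmxA Mx -scalemxAr IH scalerA exprS.
rewrite mxE (le_trans (normc_sum_le _ _))//.
have -> : (N (enum_val i) n)%:R = (M ^+ n *m block_counts 0) i 0.
  by rewrite -block_countsE mxE.
rewrite [in leRHS]mxE mulr_sumr; apply: ler_sum => j _.
have Mij : 0 <= (M ^+ n) i j by apply: mxpow_nonneg; exact: adjacency_mx_ge0.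
by rewrite normcM mxE normc_real ger0_norm// mulrCA ler_wpM2l.
Qed.

End PathSetGrowth.

(** * Exponential growth rate as a limit superior *)

Section GrowthRate.
Variable R : realType.
Local Open Scope ereal_scope.

Lemma limn_esup_le_near (u : (\bar R)^nat) l :
  (\forall n \near \oo, u n <= l) -> limn_esup u <= l.
Proof.
move=> [n _ un]; apply: ge_ereal_inf.
exists (ereal_sup (u @` [set m | (n <= m)%N])).
  by exists [set m | (n <= m)%N] => //; exists n.
by apply: ge_ereal_sup => _ [m nm <-]; exact: un.
Qed.

Lemma limn_esup_ge_near (u : (\bar R)^nat) l :
  (\forall n \near \oo, l <= u n) -> l <= limn_esup u.
Proof.
move=> [n _ un]; apply: le_ereal_inf_tmp => _ [B [m _ mB] <-].
apply: le_trans (un (maxn n m) (leq_maxl _ _)) _.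
by apply: ereal_sup_ubound; exists (maxn n m) => //; apply: mB; exact: leq_maxr.
Qed.

Lemma lne_exprn (s : R) n : (0 < s)%R -> (0 < n)%N ->
  (n%:R^-1)%:E * lne (s ^+ n)%:E = (ln s)%:E.
Proof.
move=> s0 n0; rewrite lne_EFin ?exprn_gt0// lnXn// -EFinM; congr EFin.
by rewrite -[(ln s *+ n)%R]mulr_natl mulrA mulVf ?mul1r// pnatr_eq0 -lt0n.
Qed.

Lemma exponential_growth_rate (N : nat -> nat) (rho : R) : (0 <= rho)%R ->
  (forall r, (rho < r)%R -> \forall n \near \oo, ((N n)%:R <= r ^+ n)%R) ->
  (forall s, (0 < s < rho)%R -> \forall n \near \oo, (s ^+ n <= (N n)%:R)%R) ->
  limn_esup (fun n => (n%:R^-1)%:E * lne (N n)%:R%:E) = lne rho%:E.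
Proof.
move=> rho0 Nle Nge; set L := limn_esup _.
have lne_le (x y : R) n : (0 < n)%N -> (0 <= x)%R -> (x <= y)%R ->
    (n%:R^-1)%:E * lne x%:E <= (n%:R^-1)%:E * lne y%:E.
  move=> n0 x0 xy; rewrite lee_pmul2l// ?lte_fin ?invr_gt0 ?ltr0n//.
  by rewrite lee_lne ?in_itv/= ?leey ?andbT ?lee_fin// (le_trans x0).
have Lle r : (rho < r)%R -> L <= (ln r)%:E.
  move=> rhor; have r0 : (0 < r)%R := le_lt_trans rho0 rhor.
  apply: limn_esup_le_near; near=> n.
  have n0 : (0 < n)%N by near: n; exact: nbhs_infty_gt.
  rewrite -(lne_exprn r0 n0); apply: lne_le => //.
  by near: n; exact: Nle.
have Lge s : (0 < s < rho)%R -> (ln s)%:E <= L.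
  move=> srho; have /andP[s0 _] := srho.
  apply: limn_esup_ge_near; near=> n.
  have n0 : (0 < n)%N by near: n; exact: nbhs_infty_gt.
  rewrite -(lne_exprn s0 n0); apply: lne_le => //.
    by rewrite exprn_ge0// ltW.
  by near: n; exact: Nge.
(* Comparing exponentials treats [rho = 0], where the logarithm is [-oo], together with the other
   cases. *)
apply: expeR_inj; rewrite lneK ?in_itv/= ?lee_fin ?rho0 ?leey//.
apply/eqP; rewrite eq_le; apply/andP; split.
  apply/lee_addgt0Pr => e e0; rewrite -EFinD -(@lneK _ (rho + e)%:E).
    rewrite lee_expeR lne_EFin ?Lle ?ltrDl//; exact: ltr_wpDl.
  by rewrite in_itv/= leey andbT lee_fin addr_ge0// ltW.
apply/lee_subgt0Pr => e e0; rewrite -EFinB.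
(* If [rho - e <= 0] it cannot serve as [s], but an exponential is nonnegative anyway. *)
have [re0|re0] := leP (rho - e)%R 0%R.
  by rewrite (@le_trans _ _ 0)// expeR_ge0.
rewrite -(@lneK _ (rho - e)%:E) ?in_itv/= ?leey ?andbT ?lee_fin ?(ltW re0)//.
rewrite lee_expeR -[leLHS]/(lne (rho - e)%:E) lne_EFin// Lge//.
by rewrite re0 ltrBlDr ltrDl.
Unshelve. all: by end_near.
Qed.

End GrowthRate.

(** * Entropy of the path set from two-sided bounds on block counts *)

Theorem theorem1p13 (R : realType) (A V : finType) (P : set (nat -> A))
    (G : lgraph V A) (v : V)
    (presP : is_presentation G v P) (reachG : reachable G v)
    (rrG : right_resolving G) :
  let M : 'M[R]_#|V| := adjacency_mx R G in
  path_entropy R P = lne (spectral_radius M)%:E /\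
  (irreducible_lgraph G ->
     irreducible_mx M /\ is_perron_eigenvalue M (spectral_radius M)).
Proof.
move=> M; rewrite presP.
have M0 : forall i j, 0 <= M i j by exact: adjacency_mx_ge0.
have [z [zM zrho rho0 perronM]] : exists z, [/\ complex_eigenvalue M z,
    normc z = spectral_radius M, 0 <= spectral_radius M &
    irreducible_mx M -> is_perron_eigenvalue M (spectral_radius M)].
  (* The vertex [v] makes the matrix size a successor, as the spectral lemmas demand. *)
  have : (0 < #|V|)%N by apply/fintype.card_gt0P; exists v.
  case: #|V| M M0 => // n M M0 _.
  have [z [zM zrho _]] := spectral_radius_attained M.
  exists z; split; [exact: zM|exact: zrho|exact: spectral_radius_ge0|].
  exact: perron_frobenius.
split; last first.
  by move=> /(irreducible_adjacency_mx R) irrM; split; last exact: perronM.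
apply: exponential_growth_rate => // [r rhor|s /andP[s0 srho]].
  (* Passing from the midpoint to [r] absorbs the constant [c]. *)
  have [rho_mid mid_r] := midf_lt rhor.
  have [c Nc] := num_initial_blocks_le rrG v rho_mid.
  have := near_geometric_lt c (le_trans rho0 (ltW rho_mid)) mid_r.
  by apply: filterS => n /ltW; exact: le_trans.
have z0 : z != 0 by rewrite -normc_gt0 zrho; exact: lt_trans srho.
have [u [c c0 Nc]] := eigenvalue_num_initial_blocks rrG zM z0.
have [k Nk] := num_initial_blocks_connect rrG (reachG u).
have rhoP : 0 < spectral_radius M by rewrite (lt_trans s0).
(* Let [k] be the shift from [u] to [v] and write [rho] for the spectral radius. Dividing
   [c * rho ^+ k * s ^+ n < rho ^+ n] by [rho ^+ k] gives [c * s ^+ n < rho ^+ (n - k)], which is at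
   most [c] times the count at [u] for length [n - k], hence at most [c] times the count at [v] for
   length [n]. *)
have near_s := near_geometric_lt (c * spectral_radius M ^+ k) (ltW s0) srho.
near=> n; have kn : (k <= n)%N by near: n; exact: nbhs_infty_ge.
have : c * spectral_radius M ^+ k * s ^+ n < spectral_radius M ^+ n.
  by near: n; exact: near_s.
rewrite -[in X in _ < X](subnKC kn) exprD mulrAC [ltLHS]mulrC.
rewrite ltr_pM2l ?exprn_gt0// -zrho => /ltW /le_trans /(_ (Nc _)).
rewrite ler_pM2l// => /le_trans; apply.
by rewrite ler_nat -[in leqRHS](subnKC kn).
Unshelve. all: by end_near.
Qed.
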